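(* Let $k>0$ and $p\in[1,\infty]$, and let $X,Y$ be compact, fully supported pmm-spaces. Then $\mathsf{PGW}^k_p(X,Y)=0$ if and only if $X$ and $Y$ are isomorphic.
   Context: A pmm-space is a triple $(X,d_X,\mu_X)$ with $(X,d_X)$ a complete separable metric space and $\mu_X$ a Borel probability measure; compact means $(X,d_X)$ compact; fully supported means $\operatorname{supp}\mu_X=X$. $X$ and $Y$ are isomorphic if there is a measure-preserving isometric bijection $X\to Y$. For a measure $\pi$ on $X\times Y$, $\pi_X,\pi_Y$ are its marginals; for $p<\infty$, $\|d_X-d_Y\|_{L^p(\pi\otimes\pi)}=\left(\iint|d_X(x,x')-d_Y(y,y')|^p\,d\pi(x,y)\,d\pi(x',y')\right)^{1/p}$, and for $p=\infty$ the $\pi\otimes\pi$-essential supremum. For a scalar $\epsilon\ge0$: $\mathsf{PGW}_{\epsilon,p}(X,Y)=\inf\{\|d_X-d_Y\|_{L^p(\pi\otimes\pi)}:\pi$ Borel probability measure on $X\times Y$ with $\pi_X\le(1+\epsilon)\mu_X$ and $\pi_Y\le(1+\epsilon)\mu_Y$ setwise$\}$. The robust partial Gromov–Wasserstein distance is $\mathsf{PGW}^k_p(X,Y)=\inf\{\frac{\epsilon}{1+\epsilon}:\epsilon\ge0,\ \mathsf{PGW}_{\epsilon,p}(X,Y)\le k\epsilon\}$. *)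

(* Defs.v *)
From HB Require Import structures.
From mathcomp Require Import all_boot all_order all_algebra.
From mathcomp Require Import all_classical all_reals all_analysis.

Set Implicit Arguments.
Unset Strict Implicit.
Unset Printing Implicit Defensive.

Import Order.TTheory GRing.Theory Num.Theory.
Local Open Scope classical_set_scope.
Local Open Scope ring_scope.

Section metric.
Context {R : realType} {T : Type} (dist : T -> T -> R).

Definition is_metric : Prop :=
  [/\ (forall x y, 0 <= dist x y),
      (forall x y, dist x y = 0 <-> x = y),
      (forall x y, dist x y = dist y x) &
      (forall x y z, dist x z <= dist x y + dist y z)].

Definition dball (x : T) (r : R) : set T := [set y | dist x y < r].

Definition dopen (U : set T) : Prop :=
  forall x, U x -> exists2 r : R, 0 < r & dball x r `<=` U.

Definition dcompact : Prop :=
  forall (I : Type) (U : I -> set T), (forall i, dopen (U i)) ->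
    \bigcup_i U i = setT ->
    exists2 F : set I, finite_set F & setT `<=` \bigcup_(i in F) U i.

Definition dcomplete : Prop :=
  forall u : nat -> T,
    (forall e : R, 0 < e -> exists N : nat,
       forall m n, (N <= m)%N -> (N <= n)%N -> dist (u m) (u n) < e) ->
    exists x : T, forall e : R, 0 < e -> exists N : nat,
       forall n, (N <= n)%N -> dist (u n) x < e.

Definition dseparable : Prop :=
  exists D : set T, countable D /\
    forall x (e : R), 0 < e -> exists y, D y /\ dist x y < e.

End metric.

Section pmm.
Context {R : realType} {d : measure_display} {T : measurableType d}.
Variables (dist : T -> T -> R) (mu : probability T R).

Definition borel_for : Prop :=
  (@measurable d T) = <<s dopen dist >>.

(* (X, dist, mu) is a pmm-space; mu is a Borel probability measure by its type *)
Definition pmm_space (mu' : probability T R) : Prop :=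
  [/\ is_metric dist, dcomplete dist, dseparable dist & borel_for].

Definition support : set T :=
  [set x | forall r : R, 0 < r -> (0 < mu (dball dist x r))%E].

Definition fully_supported : Prop := support = setT.

End pmm.

Section pgw.
Context {R : realType} {d1 d2 : measure_display}
  {T1 : measurableType d1} {T2 : measurableType d2}.
Variables (dist1 : T1 -> T1 -> R) (mu1 : probability T1 R)
          (dist2 : T2 -> T2 -> R) (mu2 : probability T2 R).

Definition pmm_isomorphic : Prop :=
  exists f : T1 -> T2,
    [/\ bijective f,
        (forall x x', dist2 (f x) (f x') = dist1 x x') &
        (forall B : set T2, measurable B -> mu2 B = mu1 (f @^-1` B))].

Definition marginals_le (eps : R) (pi : probability (T1 * T2)%type R) : Prop :=
  (forall A : set T1, measurable A ->
     (pi (A `*` setT) <= (1 + eps)%:E * mu1 A)%E) /\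
  (forall B : set T2, measurable B ->
     (pi (setT `*` B) <= (1 + eps)%:E * mu2 B)%E).

Definition distortion (p : \bar R) (pi : probability (T1 * T2)%type R) : \bar R :=
  Lnorm (pi \x pi)%E p
    (fun z : (T1 * T2) * (T1 * T2) =>
       (`| dist1 z.1.1 z.2.1 - dist2 z.1.2 z.2.2 |)%:E).

Definition PGW_eps (eps : R) (p : \bar R) : \bar R :=
  ereal_inf [set v | exists pi : probability (T1 * T2)%type R,
                       marginals_le eps pi /\ v = distortion p pi].

Definition PGWk (k : R) (p : \bar R) : \bar R :=
  ereal_inf [set v | exists eps : R,
     [/\ 0 <= eps, (PGW_eps eps p <= (k * eps)%:E)%E & v = (eps / (1 + eps))%:E]].

End pgw.

(* Main.v *)
(** Vanishing of PGW^k yields couplings pi whose marginals exceed those of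
    mu_X, mu_Y by a factor at most 1 + eps and whose L^p distortion is less
    than tau, with eps and tau arbitrarily small. By Markov and Fubini, pi is
    almost concentrated on the set G of pairs whose distortion against almost
    every other pair is small. Balls of a fixed radius have mass bounded below
    (compactness and full support), so any two pairs of G can be compared
    through a third one: G has uniformly small distortion, and mu_X A <= mu_Y
    B + eta whenever G sends A into B, and conversely. Weak compactness of
    couplings is thus avoided: the limit of the relations G along an
    ultrafilter is, by compactness of X and Y, the graph of a bijective
    isometry f, eventually G lies in an arbitrarily small neighbourhood of
    that graph, and this gives mu_X (f^-1 V) <= mu_Y V for V open, with the
    opposite inequality by symmetry. *)
Require Import Defs.
From HB Require Import structures.
From mathcomp Require Import all_boot all_order all_algebra.
From mathcomp Require Import all_classical all_reals all_analysis.
From mathcomp Require Import measurable_realfun ess_sup_inf lra.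

Set Implicit Arguments.
Unset Strict Implicit.
Unset Printing Implicit Defensive.

Import Order.TTheory GRing.Theory Num.Theory.
Local Open Scope classical_set_scope.
Local Open Scope ring_scope.

(** * Filters and finite families *)

Lemma filter_finite_forall (I T : Type) (U : set_system T) (F : set I)
    (P : I -> set T) {FU : Filter U} : finite_set F ->
  (forall i, F i -> U (P i)) -> U [set t | forall i, F i -> P i t].
Proof.
elim/Pchoice: I => I in F P *.
move=> /finite_fsetP[X ->] UP.
apply: filterS (filter_bigI FU UP) => t Xt i iX.
exact: Xt.
Qed.

Lemma invSn_lt_near (R : realType) (e : R) : 0 < e ->
  \forall n \near \oo, n.+1%:R^-1 < e.
Proof. by move=> e0; exact: (near_infty_natSinv_lt (PosNum e0)). Qed.

Lemma finite_lower_bound (R : realType) (I : Type) (F : set I) (e : I -> R) :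
  finite_set F -> (forall i, 0 < e i) ->
  exists2 r : R, 0 < r & forall i, F i -> r < e i.
Proof.
move=> finF e0.
have /filter_ex[r [r0 re]] : \forall r \near 0^'+, 0 < r /\ forall i, F i -> r < e i.
  apply: filterI; first exact: nbhs_right_gt.
  by apply: filter_finite_forall => // i _; exact: nbhs_right_lt.
by exists r.
Qed.

(** * Open sets, erosions and finite nets in a metric space *)

Section metric.
Context {R : realType} {T : Type} {dist : T -> T -> R}.
Hypothesis metric_dist : is_metric dist.

Lemma dball_open x r : dopen dist (dball dist x r).
Proof.
case: metric_dist => _ _ _ tri y xy; exists (r - dist x y).
  by rewrite subr_gt0.
move=> z; rewrite /dball /= => yz; move: (tri x y z); lra.
Qed.

Lemma dopenI : setI_closed (dopen dist).
Proof.
move=> A B oA oB x [/oA[r r0 rA] /oB[s s0 sB]].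
exists (Num.min r s); first by rewrite lt_min r0.
move=> y; rewrite /dball /= lt_min => /andP[xr xs].
by split; [exact: rA|exact: sB].
Qed.

Lemma dopenT : dopen dist setT. Proof. by move=> x _; exists 1. Qed.

(** The erosion of [V] by [e]: a point within [e] of it is still in [V]. For open [V] these sets
    increase to [V] as [e] decreases to 0, and they are closed, hence Borel. *)
Definition inner (V : set T) (e : R) : set T := [set y | dball dist y e `<=` V].

Lemma setC_inner_open V e : dopen dist (~` inner V e).
Proof.
case: metric_dist => _ _ _ tri y /existsNP[z /not_implyP[yz Vz]].
exists (e - dist y z); first by rewrite subr_gt0.
move=> w /= yw; apply/existsNP; exists z; apply/not_implyP; split => //.
rewrite /dball /= in yz yw *.
case: metric_dist => _ _ sym _.
by move: (tri w y z) (sym w y); lra.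
Qed.

(** The radius may vary with the centre, since the totality of the limit relation uses a radius
    chosen separately at each point. *)
Lemma dcompact_net (e : T -> R) : dcompact dist -> (forall x, 0 < e x) ->
  exists2 F : set T, finite_set F & forall x, exists2 i, F i & dist i x < e i.
Proof.
case: metric_dist => _ d0 _ _ cT e0.
have [||F finF FT] := cT T (fun x => dball dist x (e x)).
- by move=> x; exact: dball_open.
- by apply/seteqP; split => // x _; exists x => //; rewrite /dball/= (d0 x x).2.
exists F => // x; have [i Fi xi] := FT x I.
by exists i.
Qed.

End metric.

Section borel.
Context {R : realType} {d : measure_display} {T : measurableType d}.
Context {dist : T -> T -> R}.
Hypothesis borel : borel_for dist.

Lemma dopen_measurable V : dopen dist V -> measurable V.
Proof. by rewrite borel; exact: sub_sigma_algebra. Qed.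

Lemma measurable_dball x r : is_metric dist -> measurable (dball dist x r).
Proof. by move=> m; apply: dopen_measurable; exact: dball_open. Qed.

End borel.

(** * Approximate relations between two spaces and their limits *)

Section approx.
Context {R : realType} {d1 d2 : measure_display}
  {T1 : measurableType d1} {T2 : measurableType d2}.
Variables (dist1 : T1 -> T1 -> R) (mu1 : probability T1 R)
          (dist2 : T2 -> T2 -> R) (mu2 : probability T2 R).

(** The last two clauses are a Strassen-type substitute for a coupling almost carried by [G]: the
    measures are compared on sets that [G], or its converse, maps into one another. *)
Definition approx_rel (eta : R) (G : T1 -> T2 -> Prop) : Prop :=
  [/\ (forall x y x' y', G x y -> G x' y' ->
         `|dist1 x x' - dist2 y y'| <= eta),
      (forall A B, measurable A -> measurable B ->
         (forall x y, G x y -> A x -> B y) -> (mu1 A <= mu2 B + eta%:E)%E) &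
      (forall A B, measurable A -> measurable B ->
         (forall x y, G x y -> B y -> A x) -> (mu2 B <= mu1 A + eta%:E)%E)].

(** The Kuratowski limit, along [U], of the relations [G n] seen as subsets of the product. *)
Definition limit_rel (U : set_system nat) (G : nat -> T1 -> T2 -> Prop)
    (x : T1) (y : T2) : Prop :=
  forall e, 0 < e -> U [set n | exists x' y',
    [/\ G n x' y', dist1 x x' < e & dist2 y y' < e]].

End approx.
Arguments limit_rel {R d1 d2 T1 T2}.

Lemma approx_rel_sym (R : realType) (d1 d2 : measure_display)
  (T1 : measurableType d1) (T2 : measurableType d2)
  (dist1 : T1 -> T1 -> R) (mu1 : probability T1 R)
  (dist2 : T2 -> T2 -> R) (mu2 : probability T2 R) eta G :
  approx_rel dist1 mu1 dist2 mu2 eta G ->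
  approx_rel dist2 mu2 dist1 mu1 eta (fun y x => G x y).
Proof.
case=> dis H1 H2; split.
- by move=> y x y' x' Gxy Gxy'; rewrite distrC; exact: dis.
- by move=> A B mA mB GAB; apply: H2 => // x y /GAB.
- by move=> A B mA mB GAB; apply: H1 => // x y /GAB.
Qed.

Lemma limit_rel_sym (R : realType) (d1 d2 : measure_display)
  (T1 : measurableType d1) (T2 : measurableType d2)
  (dist1 : T1 -> T1 -> R) (dist2 : T2 -> T2 -> R) U G x y : Filter U ->
  limit_rel dist1 dist2 U G x y ->
  limit_rel dist2 dist1 U (fun n y x => G n x y) y x.
Proof.
move=> FU Gxy e e0; apply: filterS (Gxy _ e0) => n [x' [y' [? ? ?]]].
by exists y', x'.
Qed.

(** * The limit relation is an isometry that does not increase the measure of open sets under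
    preimage *)

Section limit.
Context {R : realType} {d1 d2 : measure_display}
  {T1 : measurableType d1} {T2 : measurableType d2}.
Context {dist1 : T1 -> T1 -> R} {mu1 : probability T1 R}
        {dist2 : T2 -> T2 -> R} {mu2 : probability T2 R}.
Hypotheses (metric1 : is_metric dist1) (metric2 : is_metric dist2).
Hypotheses (borel1 : borel_for dist1) (borel2 : borel_for dist2).
Context {U : set_system nat} {G : nat -> T1 -> T2 -> Prop}.
Hypotheses (ultraU : UltraFilter U) (ooU : \oo `<=` U).
Hypothesis approxG : forall n,
  approx_rel dist1 mu1 dist2 mu2 n.+1%:R^-1 (G n).

Local Notation Gamma := (limit_rel dist1 dist2 U G).

Let UI A B : U A -> U B -> U (A `&` B). Proof. exact: filterI. Qed.

Let U_invSn (e : R) : 0 < e -> U [set n | n.+1%:R^-1 < e].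
Proof. by move=> e0; apply: ooU; exact: invSn_lt_near. Qed.

(** If [x] had no partner, each [y] would have a radius within which [G n] eventually has no pair
    near [(x, y)]. A finite net of the second space then leaves a whole ball around [x] without
    partners, so its mass is at most [n.+1%:R^-1], against full support. *)
Lemma limit_rel_total : dcompact dist2 -> fully_supported dist1 mu1 ->
  forall x, exists y, Gamma x y.
Proof.
move=> c2 supp1 x; apply: contrapT => /forallNP noy.
have /choice[e ey] : forall y, exists e, 0 < e /\
    U [set n | forall x' y', G n x' y' -> dist1 x x' < e -> ~ dist2 y y' < e].
  move=> y; have /existsNP[e /not_implyP[e0 Ue]] := noy y.
  exists e; split => //; case: (in_ultra_setVsetC [set n | exists x' y',
    [/\ G n x' y', dist1 x x' < e & dist2 y y' < e]] ultraU) => // H.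
  apply: filterS H => n nH x' y' Gxy xx' yy'; apply: nH.
  by exists x', y'.
have [F finF Fnet] := dcompact_net metric2 c2 (fun y => (ey y).1).
have [r r0 re] := finite_lower_bound finF (fun y => (ey y).1).
have mball := measurable_dball borel1 x r metric1.
have mu_ball : (0 < mu1 (dball dist1 x r))%E.
  by have /(_ r r0) : Defs.support dist1 mu1 x by rewrite supp1.
have mu_fin : mu1 (dball dist1 x r) \is a fin_num by exact: fin_num_measure.
have f0 : 0 < fine (mu1 (dball dist1 x r)).
  by rewrite fine_gt0// mu_ball ltey_eq mu_fin.
have /filter_ex[n [near_n none_n]] :
  U ([set n : nat | n.+1%:R^-1 < fine (mu1 (dball dist1 x r))] `&`
     [set n | forall i, F i -> forall x' y', G n x' y' ->
                dist1 x x' < e i -> ~ dist2 i y' < e i]).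
  apply: filterI; first exact: U_invSn.
  by apply: filter_finite_forall => // i _; exact: (ey i).2.
have [_ H _] := approxG n.
(* The ball has no partner under [G n], so [G n] maps it into the empty set. *)
have := H _ set0 mball measurable0; rewrite measure0 add0e leNgt.
rewrite -(fineK mu_fin) lte_fin near_n => /(_ _)/negP/notP; apply => x' y' Gxy xx'.
have [i Fi iy'] := Fnet y'.
by apply: (none_n i Fi x' y' Gxy _ iy'); exact: lt_trans (re _ Fi).
Qed.

Lemma limit_rel_isometric x y x' y' : Gamma x y -> Gamma x' y' ->
  dist2 y y' = dist1 x x'.
Proof.
move=> xy xy'; apply/eqP; rewrite eq_sym -subr_eq0 -normr_le0.
apply/ler_addgt0Pr => e e0; rewrite add0r.
(* Four fifths pay for moving the two pairs into [G n], the last one for the distortion of [G n]. *)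
have e5 : 0 < e / 5 by lra.
have /filter_ex[n [[/= near_n [a [b [Gab xa yb]]]] [a' [b' [Gab' xa' yb']]]]] :=
  UI (UI (U_invSn e5) (xy _ e5)) (xy' _ e5).
have [dis _ _] := approxG n; have := dis _ _ _ _ Gab Gab'.
case: metric1 metric2 => _ _ sym1 tri1 [_ _ sym2 tri2].
move: (tri1 x a x') (tri1 a a' x') (sym1 a' x') (tri1 a x a') (tri1 x x' a') (sym1 a x).
move: (tri2 y b y') (tri2 b b' y') (sym2 b' y') (tri2 b y b') (tri2 y y' b') (sym2 b y).
move: n.+1%:R^-1 near_n => h; rewrite !ler_norml => near_n *; lra.
Qed.

Context {f : T1 -> T2}.
Hypothesis graph_f : forall x, Gamma x (f x).

(** Finitely many net points [i] have pairs of [G n] close to [(i, f i)] simultaneously. Any other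
    pair [(x, y)] of [G n] is compared with the one at a net point near [x], by the small distortion
    of [G n]. *)
Lemma near_graph (e : R) : dcompact dist1 -> 0 < e ->
  U [set n | forall x y, G n x y -> dist2 (f x) y < e].
Proof.
move=> c1 e0; have e6 : 0 < e / 6 by lra.
(* The path from [f x] to [y] through [f i] and [b] costs one [e / 6] for [f x] to [f i], one for
   [f i] to [b], and three for [b] to [y]: the distances from [a] to [i] and [i] to [x], plus the
   distortion. *)
have [F finF Fnet] := dcompact_net metric1 c1 (fun=> e6).
apply: filterS (UI (U_invSn e6)
  (filter_finite_forall finF (fun x _ => graph_f x e6))) => n [/= near_n Fn] x y Gxy.
have [i Fi ix] := Fnet x.
have [a [b [Gab ia fib]]] := Fn i Fi.
have [dis _ _] := approxG n; have := dis _ _ _ _ Gab Gxy.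
have := limit_rel_isometric (graph_f x) (graph_f i).
case: metric1 metric2 => _ _ sym1 tri1 [_ _ sym2 tri2].
move: (tri2 (f x) (f i) y) (tri2 (f i) b y) (tri1 a i x) (sym1 a i) (sym1 x i).
move: n.+1%:R^-1 near_n => h; rewrite !ler_norml => near_n *; lra.
Qed.

Lemma preimage_isometry_open V : dopen dist2 V -> dopen dist1 (f @^-1` V).
Proof.
move=> oV x /oV[r r0 rV]; exists r => // x' xx'; apply: rV.
by rewrite /dball /= (limit_rel_isometric (graph_f x) (graph_f x')).
Qed.

(** Once [G n] is within [e] of the graph, it sends the preimage of the [e]-erosion of [V] into [V].
    The erosions exhaust the open set [V], and continuity from below concludes. *)
Lemma limit_measure_le V : dcompact dist1 -> dopen dist2 V ->
  (mu1 (f @^-1` V) <= mu2 V)%E.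
Proof.
move=> c1 oV.
have minner e : measurable (f @^-1` inner (dist:=dist2) V e).
  rewrite -[X in measurable X]setCK preimage_setC; apply: measurableC.
  exact/(dopen_measurable borel1)/preimage_isometry_open/setC_inner_open.
have le_inner e : 0 < e -> (mu1 (f @^-1` inner (dist:=dist2) V e) <= mu2 V)%E.
  move=> e0; apply/lee_addgt0Pr => t t0.
  have /filter_ex[n [/= near_n Gn]] :=
    UI (U_invSn t0) (near_graph c1 e0).
  have [_ H _] := approxG n.
  apply: (le_trans (H _ V (minner e) (dopen_measurable borel2 oV) _)).
    by move=> x y /Gn fxy; exact.
  by rewrite leeD2l// lee_fin ltW.
pose F n := f @^-1` inner (dist:=dist2) V n.+1%:R^-1.
have FE : f @^-1` V = \bigcup_n F n.
  apply/seteqP; split => [x /oV[r r0 rV]|x [n _]]; last first.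
    by apply; rewrite /dball/=; case: metric2 => _ d0 _ _; rewrite (d0 _ _).2.
  have /filter_ex[n nr] : \forall n \near \oo, n.+1%:R^-1 < r by exact: invSn_lt_near.
  by exists n => // y fxy; apply: rV; exact: lt_trans nr.
have : mu1 \o F @ \oo --> mu1 (f @^-1` V).
  rewrite FE; apply: nondecreasing_cvg_mu.
  - by move=> n; exact: minner.
  - by apply: bigcupT_measurable => n; exact: minner.
  - move=> n m nm; apply/subsetPset => x Fx y fxy; apply: Fx.
    by apply: (lt_le_trans fxy); rewrite lef_pV2 ?posrE// ler_nat.
move=> cvgF; rewrite -(cvg_lim _ cvgF)//; apply: lime_le.
  by apply/cvg_ex; eexists; exact: cvgF.
by apply: nearW => n; exact: le_inner.
Qed.

End limit.

(** * Approximate relations of every precision give an isomorphism *)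

Lemma approx_rel_isomorphic (R : realType) (d1 d2 : measure_display)
    (T1 : measurableType d1) (T2 : measurableType d2)
    (dist1 : T1 -> T1 -> R) (mu1 : probability T1 R)
    (dist2 : T2 -> T2 -> R) (mu2 : probability T2 R) :
  is_metric dist1 -> borel_for dist1 -> dcompact dist1 ->
  fully_supported dist1 mu1 ->
  is_metric dist2 -> borel_for dist2 -> dcompact dist2 ->
  fully_supported dist2 mu2 ->
  (forall eta : R, 0 < eta -> exists G, approx_rel dist1 mu1 dist2 mu2 eta G) ->
  pmm_isomorphic dist1 mu1 dist2 mu2.
Proof.
move=> m1 b1 c1 s1 m2 b2 c2 s2 exG.
have /choice[G approxG] : forall n,
    exists G, approx_rel dist1 mu1 dist2 mu2 n.+1%:R^-1 G.
  by move=> n; apply: exG; rewrite invr_gt0.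
have [U [ultraU ooU]] := @ultraFilterLemma nat \oo _.
have approxG' n := approx_rel_sym (approxG n).
have /choice[f graph_f] := limit_rel_total m1 m2 b1 ultraU ooU approxG c2 s1.
have /choice[g graph_g] := limit_rel_total m2 m1 b2 ultraU ooU approxG' c1 s2.
have graph_g' y : limit_rel dist1 dist2 U G (g y) y by exact: limit_rel_sym (graph_g y).
have iso := limit_rel_isometric m1 m2 ultraU ooU approxG.
have d10 x x' : dist1 x x' = 0 <-> x = x' by case: m1.
have d20 x x' : dist2 x x' = 0 <-> x = x' by case: m2.
(* Both graphs lie in the same limit relation, whose pairs preserve distances, so distance 0 on one
   side forces distance 0 on the other. *)
have fK : cancel f g.
  by move=> x; apply/d10; rewrite -(iso _ _ _ _ (graph_g' _) (graph_f _)); exact/d20.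
have gK : cancel g f.
  by move=> y; apply/d20; rewrite (iso _ _ _ _ (graph_f _) (graph_g' _)); exact/d10.
exists f; split; first by exists g.
  by move=> x x'; exact: iso.
have oV B : dopen dist2 B -> dopen dist1 (f @^-1` B).
  exact: (preimage_isometry_open m1 m2 ultraU ooU approxG graph_f).
have mf : measurable_fun setT f.
  apply: (measurability _ b2) => _ [B oB <-]; rewrite setTI.
  exact/(dopen_measurable b1)/oV.
(* The open sets form a generating pi-system, so equality of the measures on them suffices. *)
move=> B mB; apply: (@measure_unique _ _ _ (dopen dist2) (fun=> setT) b2 _ _ _ mu2
  (pushforward mu1 f)) => //.
- exact: dopenI.
- by move=> _; exact: dopenT.
- by rewrite bigcup_const.
- move=> A oA; apply/eqP; rewrite eq_le /pushforward; apply/andP; split; last first.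
    exact: (limit_measure_le m1 m2 b1 b2 ultraU ooU approxG graph_f).
  have := limit_measure_le m2 m1 b2 b1 ultraU ooU approxG' graph_g c2 (oV _ oA).
  by rewrite -comp_preimage (_ : f \o g = id) //; apply/funext.
- by move=> _; rewrite -ge0_fin_numE//; exact: fin_num_measure.
Qed.

(** * Measurability of the distance for the product sigma-algebra *)

Lemma countable_bigcup_measurable d (T : measurableType d) (I : Type)
    (D : set I) (F : I -> set T) :
  countable D -> (forall i, measurable (F i)) -> measurable (\bigcup_(i in D) F i).
Proof.
elim/Pchoice: I => I in D F * => cD mF; rewrite bigcup_set_type.
apply: countable_bigcupT_measurable => //.
by rewrite (eq_countable (card_setT D)).
Qed.

Lemma measurable_dist (R : realType) d (T : measurableType d)
    (dist : T -> T -> R) :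
  is_metric dist -> dseparable dist -> borel_for dist ->
  measurable_fun [set: T * T] (fun z => dist z.1 z.2).
Proof.
move=> metric_dist [D [cD denseD]] borel.
apply: (measurability _ (RGenInftyO.measurableE R)) => _ [_ [c ->] <-].
rewrite setTI; pose h n : R := n.+1%:R^-1.
(* Separability writes the strict sublevel set at [c] as a countable union of rectangles of balls
   around a common dense point, with radii adding up to [c]. *)
rewrite (_ : _ @^-1` _ = \bigcup_(y in D) \bigcup_n
    (dball dist y (h n) `*` dball dist y (c - h n))).
  apply: countable_bigcup_measurable => // y; apply: bigcupT_measurable => n.
  by apply: measurableX; exact: measurable_dball.
case: metric_dist => _ _ sym tri.
apply/seteqP; split => [[x x'] /=|[x x'] [y Dy [n _ [/=]]]]; rewrite /dball/= in_itv/=.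
  (* The half is there because [h n] is spent twice: from [y] to [x], and in the radius
     [c - h n]. *)
  move=> xx'; have /filter_ex[n hn] : \forall n \near \oo, h n < (c - dist x x') / 2.
    by apply: invSn_lt_near; lra.
  have h0 : 0 < h n by rewrite invr_gt0.
  have [y [Dy xy]] := denseD x _ h0.
  exists y => //; exists n => //; split => /=; first by rewrite sym.
  by move: (tri y x x') (sym x y); lra.
by move: (tri x y x') (sym x y); lra.
Qed.

Lemma measurable_fun_dist (R : realType) d d' (T : measurableType d)
    (S : measurableType d') (dist : T -> T -> R) (u v : S -> T) :
  is_metric dist -> dseparable dist -> borel_for dist ->
  measurable_fun setT u -> measurable_fun setT v ->
  measurable_fun setT (fun z => dist (u z) (v z)).
Proof.
move=> m s b mu mv.
exact: (measurableT_comp (measurable_dist m s b) (measurable_fun_pair mu mv)).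
Qed.

(** * Tail bounds from Lebesgue norms, and masses of sections and balls *)

Section Lnorm_bounds.
Context {R : realType} {d : measure_display} {T : measurableType d}.
Variable mu : {measure set T -> \bar R}.
Local Open Scope ereal_scope.

(** A Markov bound uniform in [p]. For finite [r] the tail has mass at most [s] to the power [r],
    which is at most [s] because [s <= 1 <= r]; for [p] infinite the essential supremum is below
    [delta] and the tail is null. *)
Lemma Lnorm_tail (p : \bar R) (f : T -> \bar R) (delta s : R) :
  measurable_fun setT f -> 1 <= p -> 0 < mu setT ->
  (0 < delta)%R -> (0 < s <= 1)%R -> Lnorm mu p f < (delta * s)%:E ->
  mu [set x | delta%:E <= `|f x|] <= s%:E.
Proof.
move=> mf p1 muT delta0 /andP[s0 s1].
have mE : measurable [set x | delta%:E <= `|f x|].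
  by rewrite -[X in measurable X]setTI; apply: emeasurable_fun_c_infty => //;
    exact: measurableT_comp.
case: p p1 => [r r1|_|//]; last first.
  rewrite unlock muT => ess_lt.
  rewrite (_ : mu _ = 0) ?lee_fin ?(ltW s0)//.
  apply/negligibleP => //.
  apply: negligibleS (ess_sup_ge mu (abse \o f)) => x /= df.
  apply/negP; rewrite -ltNge; apply: lt_le_trans df; apply: (lt_le_trans ess_lt).
  by rewrite lee_fin ler_piMr// ltW.
rewrite lee_fin in r1.
have r0 : (0 < r)%R by exact: lt_le_trans r1.
apply: contraTT; rewrite -!ltNge -!leNgt => s_lt.
have pow0 (x : \bar R) : 0 <= x -> 0 <= x `^ r by move=> _; exact: poweR_ge0.
have pow_nd : {in `[0, +oo[%classic &, {homo (fun x : \bar R => x `^ r) : x y / x <= y}}.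
  move=> x y; rewrite !inE/= !in_itv/= !andbT => x0 y0 xy.
  by apply: gt0_ler_poweR => //; rewrite ?ltW// in_itv/= ?x0 ?y0 leey.
have := le_integral_comp_abse mu measurableT (measurable_poweR r) pow0 pow_nd mf delta0.
rewrite setTI poweR_EFin => Hmarkov.
rewrite unlock.
have -> : (delta * s)%:E = ((delta * s)%:E `^ r) `^ r^-1.
  by rewrite -poweRrM mulfV ?gt_eqF// poweRe1// lee_fin mulr_ge0// ltW.
apply: gt0_ler_poweR; rewrite ?invr_ge0 ?(ltW r0)//.
- by rewrite in_itv; apply/andP; split; [exact: poweR_ge0|exact: leey].
- by rewrite in_itv/= leey andbT integral_ge0// => x _; exact: poweR_ge0.
apply: le_trans Hmarkov; rewrite poweR_EFin powRM ?(ltW delta0) ?(ltW s0)// EFinM.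
apply: lee_pmul => //; rewrite ?lee_fin ?powR_ge0//.
apply: le_trans (ltW s_lt); rewrite lee_fin.
by apply: ge1r_powR; rewrite ?s0.
Qed.

Lemma Lnorm_ae0 (p : \bar R) (f : T -> \bar R) :
  measurable_fun setT f -> 1 <= p -> f = \0 %[ae mu] -> Lnorm mu p f = 0.
Proof.
move=> mf p1 f0; rewrite unlock.
case: p p1 => [r r1|_|//]; last by case: ifPn => // muT; exact: abs_ess_sup_eq0.
have r0 : r != 0%R by rewrite gt_eqF//; move: r1; rewrite lee_fin; exact: lt_le_trans.
rewrite (_ : \int[mu]_x _ = 0); first by rewrite poweR0r// invr_neq0.
rewrite -(integral0 mu setT); apply: ae_eq_integral => //.
  apply: (measurableT_comp (measurable_poweR _)); exact: measurableT_comp.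
by apply: filterS f0 => x /(_ I) fx0 _; rewrite fx0 abse0 poweR0r.
Qed.

End Lnorm_bounds.

(** By Fubini, the mass of [E] is the integral of the masses of its sections; Markov at level [s]
    then costs one of the two factors [s]. *)
Lemma product_section_tail (R : realType) d (T : measurableType d)
    (pi : probability T R) (E : set (T * T)) (s : R) : measurable E -> 0 < s ->
  ((pi \x pi) E <= (s * s)%:E)%E ->
  (pi [set z | (s%:E <= pi (xsection E z))%E] <= s%:E)%E.
Proof.
move=> mE s0 piE.
have := @le_integral_comp_abse _ _ _ pi setT measurableT (pi \o xsection E) s idfun
  (@measurable_id _ _ _) (fun _ => id) (fun _ _ _ _ => id)
  (measurable_fun_xsection pi mE) s0.
rewrite setTI /=; under eq_set do rewrite gee0_abs//.
under eq_integral do rewrite gee0_abs//.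
move=> H; rewrite -(@lee_pmul2l _ s%:E)// -EFinM.
by apply: le_trans piE; exact: H.
Qed.

(** Every ball of radius [r] contains a ball of radius [r / 2] around a point of a finite net, and
    these finitely many balls have positive mass. *)
Lemma ball_mass_lower_bound (R : realType) d (T : measurableType d)
    (dist : T -> T -> R) (mu : probability T R) (r : R) :
  is_metric dist -> borel_for dist -> dcompact dist ->
  fully_supported dist mu -> 0 < r ->
  exists2 m : R, 0 < m & forall x, (m%:E <= mu (dball dist x r))%E.
Proof.
move=> metric_dist borel cT supp r0; have r20 : 0 < r / 2 by lra.
have mball x s : measurable (dball dist x s) by exact: measurable_dball.
have [F finF Fnet] := dcompact_net metric_dist cT (fun=> r20).
have mass0 x : 0 < fine (mu (dball dist x (r / 2))).
  have /(_ _ r20) mu0 : Defs.support dist mu x by rewrite supp.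
  by rewrite fine_gt0// mu0 -ge0_fin_numE// fin_num_measure.
have [m m0 Fm] := finite_lower_bound finF mass0.
exists m => // x; have [i Fi ix] := Fnet x.
apply: (@le_trans _ _ (mu (dball dist i (r / 2)))).
  by rewrite -[leRHS]fineK ?fin_num_measure// lee_fin ltW// Fm.
apply: le_measure; rewrite ?inE//; move=> y; rewrite /dball/= => iy.
by case: metric_dist => _ _ sym tri; move: (tri x i y) (sym x i); lra.
Qed.

(** * Comparing measures through a coupling with dominated marginals *)

Section marginals.
Context {R : realType} {d d' : measure_display}
  {T : measurableType d} {T' : measurableType d'}.

(* A dominated marginal of a probability is also bounded below, since the
   total masses agree. *)
Lemma marginal_lower_bound (mu : probability T R) (pi : probability T' R)
    (h : T' -> T) (eps : R) (A : set T) :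
  0 <= eps -> measurable_fun setT h -> measurable A ->
  (forall B, measurable B -> (pi (h @^-1` B) <= (1 + eps)%:E * mu B)%E) ->
  (mu A <= pi (h @^-1` A) + eps%:E)%E.
Proof.
move=> eps0 mh mA dom.
have mhA : measurable (h @^-1` A) by rewrite -[X in measurable X]setTI; exact: mh.
have := dom _ (measurableC mA).
rewrite preimage_setC !probability_setC//.
rewrite -(fineK (fin_num_measure mu _ mA)) -(fineK (fin_num_measure pi _ mhA)).
rewrite -!EFinB -EFinM -EFinD !lee_fin => H.
have : 0 <= fine (mu A) by rewrite fine_ge0.
by nra.
Qed.

End marginals.

(** One [eps] comes from passing from [mu1] to [pi], one from passing from [pi] to [mu2], where
    [mu2 B <= 1], and [s] from the exceptional set. With general maps [h1] and [h2] the two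
    projections can be used in either order. *)
Lemma dominated_transfer (R : realType) (d1 d2 d : measure_display)
    (T1 : measurableType d1) (T2 : measurableType d2) (Z : measurableType d)
    (mu1 : probability T1 R) (mu2 : probability T2 R) (pi : probability Z R)
    (h1 : Z -> T1) (h2 : Z -> T2) (N : set Z) (eps s : R) A B :
  0 <= eps -> measurable_fun setT h1 -> measurable_fun setT h2 ->
  (forall C, measurable C -> (pi (h1 @^-1` C) <= (1 + eps)%:E * mu1 C)%E) ->
  (forall C, measurable C -> (pi (h2 @^-1` C) <= (1 + eps)%:E * mu2 C)%E) ->
  measurable N -> (pi N <= s%:E)%E -> measurable A -> measurable B ->
  h1 @^-1` A `<=` h2 @^-1` B `|` N ->
  (mu1 A <= mu2 B + (2 * eps + s)%:E)%E.
Proof.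
move=> eps0 mh1 mh2 dom1 dom2 mN piN mA mB AB.
have mhA : measurable (h1 @^-1` A) by rewrite -[X in measurable X]setTI; exact: mh1.
have mhB : measurable (h2 @^-1` B) by rewrite -[X in measurable X]setTI; exact: mh2.
have := marginal_lower_bound eps0 mh1 mA dom1.
have := dom2 _ mB.
have : (pi (h1 @^-1` A) <= pi (h2 @^-1` B) + pi N)%E.
  apply: le_trans (measureU2 _ mhB mN).
  by apply: le_measure; rewrite ?inE//; exact: measurableU.
have : (mu2 B <= 1)%E by exact: probability_le1.
move: piN.
rewrite -(fineK (fin_num_measure mu1 _ mA)) -(fineK (fin_num_measure mu2 _ mB)).
rewrite -(fineK (fin_num_measure pi _ mhA)) -(fineK (fin_num_measure pi _ mhB)).
rewrite -(fineK (fin_num_measure pi _ mN)).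
rewrite -EFinM -!EFinD !lee_fin; nra.
Qed.

(** * From vanishing distance to approximate relations, and from isomorphisms to couplings *)

Section distortion.
Context {R : realType} {d1 d2 : measure_display}
  {T1 : measurableType d1} {T2 : measurableType d2}.
Context {dist1 : T1 -> T1 -> R} {mu1 : probability T1 R}
        {dist2 : T2 -> T2 -> R} {mu2 : probability T2 R}.
Hypotheses (pmm1 : pmm_space dist1 mu1) (pmm2 : pmm_space dist2 mu2).

Let gap (z : (T1 * T2) * (T1 * T2)) : \bar R :=
  (`| dist1 z.1.1 z.2.1 - dist2 z.1.2 z.2.2 |)%:E.

Lemma measurable_gap : measurable_fun setT gap.
Proof.
case: pmm1 pmm2 => m1 _ s1 b1 [m2 _ s2 b2].
apply/measurable_EFinP; apply: measurableT_comp => //; apply: measurable_funB.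
  by apply: measurable_fun_dist => //; exact: measurableT_comp.
by apply: measurable_fun_dist => //; exact: measurableT_comp.
Qed.

Lemma PGWk_eq0_coupling (k tau : R) (p : \bar R) : 0 < k -> 0 < tau ->
  PGWk dist1 mu1 dist2 mu2 k p = 0%E ->
  exists eps (pi : probability (T1 * T2)%type R),
    [/\ 0 <= eps, eps < tau, marginals_le mu1 mu2 eps pi &
        (distortion dist1 dist2 p pi < tau%:E)%E].
Proof.
move=> k0 tau0 PGW0.
(* An [eps] below [c] satisfies both [eps < tau] and [k * eps < tau]; it is recovered from
   [eps / (1 + eps)] by monotonicity. *)
pose c := Num.min tau (tau / k).
have c0 : 0 < c by rewrite lt_min tau0 divr_gt0.
have : (PGWk dist1 mu1 dist2 mu2 k p < (c / (1 + c))%:E)%E.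
  by rewrite PGW0 lte_fin divr_gt0// addr_gt0.
move=> /ereal_inf_lt[_ [eps [eps0 PGW_le ->]]]; rewrite lte_fin => eps_c.
have {}eps_c : eps < c.
  move: eps_c; rewrite ltr_pdivrMr ?ltr_wpDr// mulrAC ltr_pdivlMr; last by lra.
  by nra.
have : (PGW_eps dist1 mu1 dist2 mu2 eps p < tau%:E)%E.
  apply: (le_lt_trans PGW_le); rewrite lte_fin mulrC -ltr_pdivlMr//.
  by apply: (lt_le_trans eps_c); rewrite ge_min lexx orbT.
move=> /ereal_inf_lt[_ [pi [marg ->]]] dis.
by exists eps, pi; split=> //; apply: (lt_le_trans eps_c); rewrite ge_min lexx.
Qed.

(* The relation is the set of pairs at which the distortion is small against
   almost every other pair; two such pairs are compared through a third one
   whose first coordinate is near that of the second. *)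
Lemma PGWk_eq0_approx_rel (k eta : R) (p : \bar R) :
  dcompact dist1 -> fully_supported dist1 mu1 -> 0 < k -> (1 <= p)%E ->
  PGWk dist1 mu1 dist2 mu2 k p = 0%E -> 0 < eta ->
  exists G, approx_rel dist1 mu1 dist2 mu2 eta G.
Proof.
move=> c1 supp1 k0 p1 PGW0 eta0.
case: (pmm1) => m1 _ _ b1; case: (pmm2) => m2 _ _ b2.
(* The comparison through a third pair costs [4 * r]: the gap against it is used twice, and so is
   the distance from [x'] to its first coordinate. *)
pose r := eta / 4; have r0 : 0 < r by rewrite /r; lra.
have [m m0 mball] := ball_mass_lower_bound m1 b1 c1 supp1 r0.
(* With [eps < s], the bound [m / 4] makes [2 * s + eps] less than the mass of a ball, and [eta / 4]
   makes [2 * eps + s] less than [eta]. *)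
pose s := Num.min (1 / 2) (Num.min (m / 4) (eta / 4)).
have s0 : 0 < s by rewrite !lt_min; apply/and3P; split; lra.
have [s1 sm seta] : [/\ s <= 1 / 2, s <= m / 4 & s <= eta / 4].
  by split; rewrite !ge_min lexx ?orbT.
(* The factor [s * s] serves two successive tail estimates: on the product, then on sections. *)
have tau0 : 0 < Num.min s (r * (s * s)) by rewrite lt_min s0 !mulr_gt0.
have [eps [pi [eps0]]] := PGWk_eq0_coupling k0 tau0 PGW0.
rewrite lt_min => /andP[eps_s _] [marg1 marg2] dis.
have ss : 0 < s * s <= 1 by apply/andP; split; nra.
have {}dis : (Lnorm (pi \x pi) p gap < (r * (s * s))%:E)%E.
  by apply: (lt_le_trans dis); rewrite lee_fin ge_min lexx orbT.
have total : (0 < (pi \x pi) setT)%E.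
  by rewrite -setXTT [ltRHS]product_measure1E// mule_gt0// [ltRHS]probability_setT.
have tail := Lnorm_tail measurable_gap p1 total r0 ss dis.
set E := [set x | _] in tail.
have mE : measurable E.
  rewrite -[X in measurable X]setTI; apply: emeasurable_fun_c_infty => //.
  by apply: measurableT_comp => //; exact: measurable_gap.
have bad_s := product_section_tail mE s0 tail.
set bad := [set z | _] in bad_s.
have mbad : measurable bad.
  rewrite -[X in measurable X]setTI; apply: emeasurable_fun_c_infty => //.
  exact: measurable_fun_xsection.
have dom1 C : measurable C -> (pi (fst @^-1` C) <= (1 + eps)%:E * mu1 C)%E.
  by move=> mC; rewrite -setXT; exact: marg1.
have dom2 C : measurable C -> (pi (snd @^-1` C) <= (1 + eps)%:E * mu2 C)%E.
  by move=> mC; rewrite -setTX; exact: marg2.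
exists (fun x y => ~ bad (x, y)); split.
- move=> x y x' y' good good'.
  (* Two good pairs have exceptional sections of mass less than [s] each, which cannot cover the
     cylinder over a ball, of mass at least [m - eps]. *)
  have [[x'' y''] [x'x'' /= xx'' xx']] : exists z,
    [/\ dball dist1 x' r z.1, ~ E ((x, y), z) & ~ E ((x', y'), z)].
    apply: contrapT => none.
    have sub : fst @^-1` dball dist1 x' r `<=` xsection E (x, y) `|` xsection E (x', y').
      move=> z x'z; apply: contrapT => /not_orP[]; rewrite /xsection/= !inE => Ez Ez'.
      by apply: none; exists z.
    have mb := measurable_dball b1 x' r m1.
    have mb' : measurable (fst @^-1` dball dist1 x' r : set (T1 * T2)).
      by rewrite -[X in measurable X]setTI; exact: measurable_fst.
    have mx z : measurable (xsection E z) by exact: measurable_xsection.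
    have := marginal_lower_bound eps0 measurable_fst mb dom1.
    have : (pi (fst @^-1` dball dist1 x' r) <=
        pi (xsection E (x, y)) + pi (xsection E (x', y')))%E.
      apply: le_trans (measureU2 _ (mx _) (mx _)).
      by apply: le_measure; rewrite ?inE//; exact: measurableU.
    move: (mball x') good good'; rewrite /bad/= => + /negP + /negP; rewrite -!ltNge.
    rewrite -(fineK (fin_num_measure mu1 _ mb)) -(fineK (fin_num_measure pi _ mb')).
    rewrite -(fineK (fin_num_measure pi _ (mx (x, y)))).
    rewrite -(fineK (fin_num_measure pi _ (mx (x', y')))).
    rewrite -!EFinD !lee_fin !lte_fin; lra.
  move/negP: xx''; move/negP: xx'; rewrite -!ltNge !lte_fin !normr_id.
  move: x'x''; rewrite /dball/=.
  case: m1 m2 => _ _ sym1 tri1 [_ _ sym2 tri2].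
  move: (tri1 x x'' x') (sym1 x'' x') (tri1 x x' x'').
  move: (tri2 y y'' y') (sym2 y'' y') (tri2 y y' y'').
  rewrite !ltr_norml !ler_norml /r => ? ? ? ? ? ? ? /andP[? ?] /andP[? ?].
  by apply/andP; split; lra.
- move=> A B mA mB AB.
  apply: (le_trans (@dominated_transfer _ _ _ _ _ _ _ _ _ pi fst snd bad eps s A B
     eps0 _ _ dom1 dom2 mbad bad_s mA mB _)) => //.
    move=> [x y] /= Ax; have [bz|gz] := pselect (bad (x, y));
      [by right|by left; exact: AB gz Ax].
  by rewrite leeD2l// lee_fin; lra.
- move=> A B mA mB AB.
  apply: (le_trans (@dominated_transfer _ _ _ _ _ _ _ _ _ pi snd fst bad eps s B A
     eps0 _ _ dom2 dom1 mbad bad_s mB mA _)) => //.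
    move=> [x y] /= By; have [bz|gz] := pselect (bad (x, y));
      [by right|by left; exact: AB gz By].
  by rewrite leeD2l// lee_fin; lra.
Qed.

Lemma PGWk_ge0 (k : R) (p : \bar R) : (0 <= PGWk dist1 mu1 dist2 mu2 k p)%E.
Proof.
apply: le_ereal_inf_tmp => _ [eps [eps0 _ ->]].
by rewrite lee_fin divr_ge0// addr_ge0.
Qed.

(** The coupling is the image of [mu1] under [x |-> (x, f x)]; it is carried by the graph of the
    isometry [f], where the distortion vanishes. *)
Lemma isomorphic_coupling (p : \bar R) : (1 <= p)%E ->
  pmm_isomorphic dist1 mu1 dist2 mu2 ->
  exists pi : probability (T1 * T2)%type R,
    marginals_le mu1 mu2 0 pi /\ distortion dist1 dist2 p pi = 0%E.
Proof.
move=> p1 [f [_ isof mu2E]].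
case: (pmm1) => m1 _ s1 b1; case: (pmm2) => m2 _ s2 b2.
have mf : measurable_fun setT f.
  apply: (measurability _ b2) => _ [B oB <-]; rewrite setTI.
  apply: (dopen_measurable b1) => x /oB[r r0 rB]; exists r => // x' xx'.
  by apply: rB; rewrite /dball/= isof.
have mg : measurable_fun setT (fun x => (x, f x)) by exact: measurable_fun_pair.
pose g : {mfun T1 >-> (T1 * T2)%type} := mfun_Sub (mem_set mg).
pose pi : probability (T1 * T2)%type R := distribution mu1 g.
have piE A : pi A = mu1 ((fun x => (x, f x)) @^-1` A) by [].
exists pi; split.
  rewrite /marginals_le addr0; split=> A mA; rewrite mul1e piE.
    by rewrite (_ : _ @^-1` _ = A)//; apply/seteqP; split=> [x []|x].
  rewrite (mu2E _ mA) (_ : _ @^-1` _ = f @^-1` A)//.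
  by apply/seteqP; split=> [x []|x].
apply: Lnorm_ae0 => //; first exact: measurable_gap.
(* Written as the zero set of a measurable function, the graph is visibly measurable. *)
pose graph := [set z : T1 * T2 | dist2 (f z.1) z.2 = 0].
have mgraph : measurable graph.
  have : measurable_fun [set: T1 * T2] (fun z => dist2 (f z.1) z.2).
    by apply: measurable_fun_dist => //; exact: measurableT_comp.
  by move=> /(_ measurableT [set 0] (measurable_set1 0)); rewrite setTI.
have pi_graph : pi (~` graph) = 0%E.
  rewrite piE (_ : _ @^-1` _ = set0) ?measure0//.
  by apply/seteqP; split=> // x; apply; case: m2 => _ d0 _ _; exact/d0.
have mGC := measurableC mgraph.
have null : (pi \x pi)%E.-negligible ((~` graph `*` setT) `|` (setT `*` ~` graph)).
  apply: negligibleU; apply/negligibleP; try exact: measurableX.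
    by rewrite [LHS]product_measure1E// [X in (X * _)%E]pi_graph mul0e.
  by rewrite [LHS]product_measure1E// [X in (_ * X)%E]pi_graph mule0.
apply: negligibleS null.
move=> [[x y] [x' y']] /= ne; apply: contrapT => /not_orP[].
rewrite /graph/= => /not_andP[/contrapT Hxy|//] /not_andP[//|/contrapT Hxy'].
apply: ne => _; rewrite /=.
case: m2 => _ d0 _ _.
by rewrite -((d0 _ _).1 Hxy) -((d0 _ _).1 Hxy') isof subrr normr0.
Qed.

End distortion.

(** * The equivalence *)

Theorem theorem4p2 (R : realType)
  (d1 : measure_display) (T1 : measurableType d1)
  (dist1 : T1 -> T1 -> R) (mu1 : probability T1 R)
  (d2 : measure_display) (T2 : measurableType d2)
  (dist2 : T2 -> T2 -> R) (mu2 : probability T2 R)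
  (k : R) (p : \bar R) :
  0 < k -> (1 <= p)%E ->
  pmm_space dist1 mu1 -> dcompact dist1 -> fully_supported dist1 mu1 ->
  pmm_space dist2 mu2 -> dcompact dist2 -> fully_supported dist2 mu2 ->
  (PGWk dist1 mu1 dist2 mu2 k p = 0%E <-> pmm_isomorphic dist1 mu1 dist2 mu2).
Proof.
move=> k0 p1 pmm1 c1 supp1 pmm2 c2 supp2; split => [PGW0|iso].
  case: (pmm1) (pmm2) => m1 _ _ b1 [m2 _ _ b2].
  apply: approx_rel_isomorphic => // eta eta0.
  exact: (PGWk_eq0_approx_rel pmm1 pmm2 c1 supp1 k0 p1 PGW0 eta0).
have [pi [marg dis]] := isomorphic_coupling pmm1 pmm2 p1 iso.
apply/eqP; rewrite eq_le PGWk_ge0 andbT.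
(* The value [eps = 0] is admissible, since the isomorphism gives an exact coupling of zero
   distortion. *)
apply: ge_ereal_inf; exists 0%E => //; exists 0; split => //; last by rewrite mul0r.
by rewrite mulr0; apply: ge_ereal_inf; exists 0%E => //; exists pi.
Qed.
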